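(* Let $G=(V,E)$ be a graph and let $k\in\mathbb{Z}$ with $k\ge 2$. Then $\nabla^k G$ is critical if and only if $k\,(\omega(G)+|V|)$ is even.
   Context: All graphs are finite and simple; $|G|=|V|$ denotes the number of vertices of $G$. A coloring of a graph $G=(V,E)$ is a surjective map $\ell:V\to C$ onto a finite set $C$ of colors; it need not be proper. It is pseudocomplete if for any two distinct colors $i,j\in C$ there is an edge $uv\in E$ with $\{\ell(u),\ell(v)\}=\{i,j\}$. The pseudoachromatic number $\Psi(G)$ is the greatest number of colors used in a pseudocomplete coloring of $G$ (so $\Psi$ of the graph with no vertices is $0$). $\omega(G)$ is the clique number. $\nabla^k G$ is the join of $k$ copies of $G$: the disjoint union of $k$ copies of $G$ together with all edges between vertices in different copies. For an integer $0\le j\le |G|$, $\operatorname{mpd}_G(j)=\min\{\Psi(G)-\Psi(G\setminus X) : X\subseteq V,\ |X|=j\}$, where $G\setminus X$ is the subgraph induced on $V\setminus X$. $G$ is critical if $\operatorname{mpd}_G(j)\ge\lceil j/2\rceil$ for all $0\le j\le |G|$. *)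

(* Defs.v *)
From mathcomp Require Import all_boot.
Set Implicit Arguments.
Unset Strict Implicit.
Unset Printing Implicit Defensive.

Record sgraph := SGraph {
  vertex :> finType;
  adj : rel vertex;
  adj_sym : symmetric adj;
  adj_irrefl : irreflexive adj
}.

Definition is_clique (G : sgraph) (S : {set G}) : bool :=
  [forall u in S, forall v in S, (u != v) ==> adj u v].

Definition clique_number (G : sgraph) : nat :=
  \max_(S : {set G} | is_clique S) #|S|.

Section Coloring.
Variables (G : sgraph) (C : finType).

Definition is_coloring (f : G -> C) : bool := [forall c, exists v, f v == c].

Definition is_pseudocomplete (f : G -> C) : bool :=
  [forall i, forall j, (i != j) ==>
     [exists u, exists v, adj u v && ([set f u; f v] == [set i; j])]].

End Coloring.

(* Surjectivity bounds the number of colors by #|G|, and color sets of size n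
   may be taken to be 'I_n, see psi_ge and psi_attained. *)
Definition psi (G : sgraph) : nat :=
  \max_(n < #|G|.+1 | [exists f : {ffun G -> 'I_n},
                         is_coloring f && is_pseudocomplete f]) n.

Section Induced.
Variables (G : sgraph) (S : {set G}).

Definition induced_adj : rel {x : G | x \in S} :=
  fun u v => adj (val u) (val v).

Lemma induced_sym : symmetric induced_adj.
Proof. by move=> u v; apply: adj_sym. Qed.

Lemma induced_irrefl : irreflexive induced_adj.
Proof. by move=> u; apply: adj_irrefl. Qed.

Definition induced : sgraph := SGraph induced_sym induced_irrefl.

End Induced.

Definition del_vertices (G : sgraph) (X : {set G}) : sgraph := induced (~: X).

Section Join.
Variables (k : nat) (G : sgraph).

(* The vertex (i, u) is the copy of u in the i-th copy of G. *)
Definition join_adj : rel ('I_k * G) :=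
  fun x y => if x.1 == y.1 then adj x.2 y.2 else true.

Lemma join_sym : symmetric join_adj.
Proof. by move=> x y; rewrite /join_adj eq_sym adj_sym. Qed.

Lemma join_irrefl : irreflexive join_adj.
Proof. by move=> x; rewrite /join_adj eqxx adj_irrefl. Qed.

Definition join_copies : sgraph := SGraph join_sym join_irrefl.

End Join.

(* Truncated subtraction is harmless because psi is monotone (psi_del_le). Every
   value is at most psi G, so the default psi G does not affect the minimum
   when j <= #|G| (mpd_le, mpd_attained). *)
Definition mpd (G : sgraph) (j : nat) : nat :=
  \big[minn/psi G]_(X : {set G} | #|X| == j) (psi G - psi (del_vertices X)).

(* uphalf j is the ceiling of j / 2. *)
Definition critical (G : sgraph) : Prop :=
  forall j, j <= #|G| -> uphalf j <= mpd G j.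

Lemma psi_ge (G : sgraph) (C : finType) (f : G -> C) :
  is_coloring f -> is_pseudocomplete f -> #|C| <= psi G.
Proof.
move=> /forallP cf /forallP pf.
have le_CG : #|C| < #|G|.+1.
  have sur c : {v | f v = c} by case/existsP/sigW: (cf c) => v /eqP; exists v.
  rewrite ltnS -(@card_codom _ _ (fun c => sval (sur c))) ?max_card //.
  by move=> c d eq_cd; rewrite -(svalP (sur c)) eq_cd (svalP (sur d)).
apply: (@leq_bigmax_cond _ _ (fun n : 'I_#|G|.+1 => n : nat) (Ordinal le_CG)).
apply/existsP; exists [ffun v => enum_rank (f v)]; apply/andP; split.
  apply/forallP=> i; have /existsP[v /eqP fv] := cf (enum_val i).
  by apply/existsP; exists v; rewrite ffunE fv enum_valK.
apply/forallP=> i; apply/forallP=> j; apply/implyP=> ij.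
have /forallP/(_ (enum_val j))/implyP := pf (enum_val i).
rewrite (inj_eq enum_val_inj) => /(_ ij) /existsP[u /existsP[v /andP[uv /eqP E]]].
apply/existsP; exists u; apply/existsP; exists v; rewrite uv !ffunE /=.
have := congr1 (fun A : {set C} => enum_rank @: A) E.
by rewrite !imsetU !imset_set1 !enum_valK => ->.
Qed.

Lemma psi_attained (G : sgraph) :
  exists f : G -> 'I_(psi G), is_coloring f && is_pseudocomplete f.
Proof.
pose P (n : 'I_#|G|.+1) := [exists f : {ffun G -> 'I_n},
                              is_coloring f && is_pseudocomplete f].
case: (boolP [exists n, P n]) => [/existsP[n Pn]|nP].
  have cP : 0 < #|P| by apply/card_gt0P; exists n.
  have [m Pm E] := eq_bigmax_cond (fun n : 'I_#|G|.+1 => n : nat) cP.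
  have -> : psi G = m by rewrite -E.
  by have /existsP[f Hf] := Pm; exists f.
have G0 : #|G| = 0.
  apply/eqP; apply: contraNT nP; rewrite -lt0n => G0.
  have lt1 : 1 < #|G|.+1 by [].
  have /card_gt0P[v _] := G0.
  apply/existsP; exists (Ordinal lt1); apply/existsP; exists [ffun _ => ord0].
  apply/andP; split; apply/forallP=> i.
    by apply/existsP; exists v; rewrite ffunE (ord1 i).
  by apply/forallP=> j; rewrite (ord1 i) (ord1 j) eqxx.
have noG (v : G) : False by have := card0_eq G0 v; rewrite inE.
have p0 : psi G = 0.
  rewrite /psi big1 // => -[[|n] /= lt_n] _ //.
  by rewrite G0 in lt_n.
exists (fun v => False_rect _ (noG v)); apply/andP.
by split; apply/forallP; rewrite p0 => -[].
Qed.

Lemma psi_del_le (G : sgraph) (X : {set G}) : psi (del_vertices X) <= psi G.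
Proof.
have [f /andP[/forallP cf /forallP pf]] := psi_attained (del_vertices X).
move: f cf pf; case: (psi (del_vertices X)) => [//|n] f cf pf.
pose g (v : G) : 'I_n.+1 := if insub v is Some w then f w else ord0.
have gE (w : del_vertices X) : g (val w) = f w by rewrite /g valK.
rewrite -[leqLHS]card_ord; apply: (@psi_ge _ _ g).
  apply/forallP=> c; have /existsP[w /eqP fw] := cf c.
  by apply/existsP; exists (val w); rewrite gE fw.
apply/forallP=> i; apply/forallP=> j; apply/implyP=> ij.
have /forallP/(_ j)/implyP/(_ ij)/existsP[u /existsP[v uv]] := pf i.
by apply/existsP; exists (val u); apply/existsP; exists (val v); rewrite !gE.
Qed.

Lemma mpd_le (G : sgraph) (X : {set G}) :
  mpd G #|X| <= psi G - psi (del_vertices X).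
Proof.
rewrite /mpd; have := mem_index_enum X; elim: (index_enum _) => //= Y r IHr.
rewrite inE big_cons => /predU1P[<-|/IHr le_r]; first by rewrite eqxx geq_minl.
by case: ifP => // _; rewrite geq_min le_r orbT.
Qed.

Lemma mpd_attained (G : sgraph) (j : nat) : j <= #|G| ->
  exists2 X : {set G}, #|X| = j & mpd G j = psi G - psi (del_vertices X).
Proof.
move=> le_jG.
have [X0 /eqP cX0] : exists X : {set G}, #|X| == j.
  exists [set x in take j (enum G)].
  rewrite cardsE (card_uniqP _) ?take_uniq ?enum_uniq // size_take -cardE.
  by case: ltngtP le_jG => // ->.
have [//|X /eqP cX minX] :=
  @arg_minnP _ X0 (fun X : {set G} => #|X| == j)
    (fun X => psi G - psi (del_vertices X)); first exact/eqP.
exists X => //; apply/eqP; rewrite eqn_leq -{1}cX mpd_le /=.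
rewrite /mpd; elim/big_ind: _ => [|a b Ha Hb|Y cY]; first exact: leq_subr.
  by rewrite leq_min Ha.
exact: minX.
Qed.

(* Main.v *)
Require Import Defs.
From mathcomp Require Import all_boot zify.

Set Implicit Arguments.
Unset Strict Implicit.
Unset Printing Implicit Defensive.

(** Write [w] for the clique number of [G], [n] for its order and [H] for the
join of [k] copies of [G].

In a pseudocomplete coloring the vertices that are alone in their color class
form a clique, and every other class has at least two vertices.  Hence every
graph satisfies [2 * psi <= clique_number + order] ([psi_clique_bound]).

For [H], whose clique number is at most [k * w], the bound [k * (w + n)] on
[2 * psi H] is attained up to parity.  Fix a maximum clique [Q] of [G], give
each vertex in a copy of [Q] a color of its own, and match the remaining
[k * (n - w)] vertices into pairs across distinct copies.  Any vertex lies
outside the copy of one of the two vertices of a pair, so it is adjacent to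
that one; thus a pair meets every other color whatever the edges of [G].  At
most one vertex is left over by the matching, exactly when [k * (n - w)] is
odd, and the coloring does not need it ([psi_join_del_leftover]).

If [k * (w + n)] is even then [2 * psi H = k * (w + n)], while deleting [j]
vertices lowers the upper bound by [j], so [psi] drops by at least half of [j],
rounded up.  If it is odd, deleting the leftover vertex does not lower [psi],
which contradicts criticality at [j = 1]. *)

(** * Clique numbers *)

Lemma clique_adj (G : sgraph) (S : {set G}) (u v : G) :
  is_clique S -> u \in S -> v \in S -> u != v -> adj u v.
Proof. by move=> /forall_inP cS /cS/forall_inP cu /cu/implyP. Qed.

Lemma cliqueI (G : sgraph) (S : {set G}) :
  {in S &, forall u v, u != v -> adj u v} -> is_clique S.
Proof.
move=> cS; apply/forall_inP=> u Su; apply/forall_inP=> v Sv.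
by apply/implyP; apply: cS.
Qed.

Lemma clique_number_ge (G : sgraph) (S : {set G}) :
  is_clique S -> #|S| <= clique_number G.
Proof. exact: (@leq_bigmax_cond _ _ (fun S : {set G} => #|S|)). Qed.

Lemma max_clique (G : sgraph) :
  exists2 Q : {set G}, is_clique Q & #|Q| = clique_number G.
Proof.
have cl0 : is_clique (set0 : {set G}) by apply: cliqueI => u; rewrite inE.
have cP : 0 < #|[pred S : {set G} | is_clique S]|.
  by apply/card_gt0P; exists set0.
have [Q clQ E] := eq_bigmax_cond (fun S : {set G} => #|S|) cP.
by exists Q; rewrite // -E.
Qed.

Lemma clique_number_induced (G : sgraph) (A : {set G}) :
  clique_number (induced A) <= clique_number G.
Proof.
have [Q clQ <-] := max_clique (induced A).
rewrite -(card_imset _ val_inj); apply/clique_number_ge/cliqueI.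
move=> _ _ /imsetP[u Qu ->] /imsetP[v Qv ->]; rewrite (inj_eq val_inj) => uv.
exact: (clique_adj clQ Qu Qv uv).
Qed.

(** A clique of the join meets each copy of [G] in a clique of [G]. *)
Lemma clique_number_join (k : nat) (G : sgraph) :
  clique_number (join_copies k G) <= k * clique_number G.
Proof.
have [Q clQ <-] := max_clique (join_copies k G).
rewrite -[X in _ <= X * _]card_ord -sum_nat_const -sum1_card.
rewrite (partition_big (fun x : 'I_k * G => x.1) xpredT) //=.
apply: leq_sum => i _.
pose S := [set u : G | ((i, u) : join_copies k G) \in Q].
have clS : is_clique S.
  apply: cliqueI => u v; rewrite !inE => Qu Qv uv.
  have := clique_adj clQ Qu Qv; rewrite /adj /= /join_adj /= eqxx; apply.
  by apply: contra uv => /eqP[->].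
apply: leq_trans (clique_number_ge clS); rewrite sum1_card.
have pair_inj : injective (pair i : G -> 'I_k * G) by move=> u v [].
rewrite -(card_imset (mem S) pair_inj).
apply/subset_leq_card/subsetP=> -[j u].
rewrite unfold_in /= => /andP[Qu /eqP ji].
by apply/imsetP; exists u; rewrite ?inE ?ji // -?ji.
Qed.

(** * The upper bound on the pseudoachromatic number *)

(** Each color class is counted once by its vertices and once more by its
vertices that are alone in their class, which makes at least two; these lone
vertices form a clique since an edge joining their two colors must join them. *)
Lemma psi_clique_bound (G : sgraph) : (psi G).*2 <= clique_number G + #|G|.
Proof.
have [f /andP[/forallP sur_f /forallP pc_f]] := psi_attained G.
pose lone := [set u | [forall v, (f v == f u) ==> (v == u)]].
have loneP u v : u \in lone -> f v = f u -> v = u.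
  by rewrite inE => /forallP/(_ v)/implyP Hu /eqP/Hu/eqP.
have cl_lone : is_clique lone.
  apply: cliqueI => u v Lu Lv uv.
  have fuv : f u != f v by apply: contra uv => /eqP E; rewrite (loneP v u).
  have /forallP/(_ (f v))/implyP/(_ fuv) := pc_f (f u).
  case/existsP=> x /existsP[y /andP[xy /eqP E]].
  have [fx fy] : f x \in [set f u; f v] /\ f y \in [set f u; f v].
    by rewrite -E !inE !eqxx orbT.
  have [fu fv] : f u \in [set f x; f y] /\ f v \in [set f x; f y].
    by rewrite E !inE !eqxx orbT.
  move: fx fy fu fv fuv; rewrite !inE.
  case/orP=> /eqP fx; case/orP=> /eqP fy; rewrite !fx !fy ?orbb.
  - by move=> _ /eqP ->; rewrite eqxx.
  - by rewrite -(loneP u x) // -(loneP v y).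
  - by rewrite -(loneP v x) // -(loneP u y) // adj_sym.
  - by move=> /eqP ->; rewrite eqxx.
apply: leq_trans (leq_add (clique_number_ge cl_lone) (leqnn _)).
rewrite -muln2 -[X in X * _]card_ord -sum_nat_const -!sum1_card.
rewrite (partition_big f xpredT) //.
rewrite [X in _ <= _ + X](partition_big f xpredT) //.
rewrite -big_split; apply: leq_sum => c _.
have /existsP[u /eqP fu] := sur_f c; rewrite !sum1_card.
have [Lu|] := boolP (u \in lone).
  by apply: (@leq_add 1 1); apply/card_gt0P; exists u;
     rewrite unfold_in ?Lu fu; apply: eqxx.
rewrite inE negb_forall => /existsP[v]; rewrite negb_imply => /andP[/eqP fv vu].
apply: leq_trans (leq_addl _ _); rewrite -[2]/(true.+1) -vu -cards2.
apply/subset_leq_card/subsetP=> x; rewrite !inE => /orP[]/eqP->.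
  by rewrite unfold_in fv fu; apply: eqxx.
by rewrite unfold_in fu; apply: eqxx.
Qed.

Lemma psi_del_bound (G : sgraph) (X : {set G}) :
  (psi (del_vertices X)).*2 + #|X| <= clique_number G + #|G|.
Proof.
have := psi_clique_bound (del_vertices X).
have := clique_number_induced (~: X).
have : #|{: del_vertices X}| = #|~: X| by rewrite card_sig; apply: eq_card.
by have := cardsC X; rewrite /del_vertices; lia.
Qed.

Lemma psi_join_bound (k : nat) (G : sgraph) :
  (psi (join_copies k G)).*2 <= k * (clique_number G + #|G|).
Proof.
have := psi_clique_bound (join_copies k G); have := clique_number_join k G.
have -> : #|join_copies k G| = k * #|G| by rewrite card_prod card_ord.
by rewrite mulnDr; lia.
Qed.

(** * Coloring a join *)

(** Coloring only part of the vertices avoids writing a function on the subtype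
of the vertices that survive the deletion. *)
Lemma psi_ge_partial (G : sgraph) (C : finType) (f : G -> option C) :
  (forall c, exists v, f v = Some c) ->
  (forall c d, c != d ->
    exists u v, [/\ adj u v, f u = Some c & f v = Some d]) ->
  #|C| <= psi (del_vertices [set v | f v == None]).
Proof.
move=> sur_f pc_f; set X := [set v | _].
have [c0 _|/eq_card0-> //] := pickP (mem C).
have inX v c : f v = Some c -> v \in ~: X by move=> fv; rewrite !inE fv.
pose g (v : del_vertices X) := odflt c0 (f (val v)).
have gE v c (fv : f v = Some c) (Xv : v \in ~: X) : g (exist _ v Xv) = c.
  by rewrite /g /= fv.
apply: (@psi_ge _ _ g).
  apply/forallP=> c; have [v fv] := sur_f c.
  by apply/existsP; exists (exist _ v (inX v c fv)); rewrite (gE v c).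
apply/forallP=> c; apply/forallP=> d; apply/implyP=> /pc_f[u [v [uv fu fv]]].
apply/existsP; exists (exist _ u (inX u c fu)).
apply/existsP; exists (exist _ v (inX v d fv)).
by rewrite (gE u c) // (gE v d) // eqxx andbT.
Qed.

Section JoinColoring.
Variables (k : nat) (G : sgraph) (Q : {set G}).
Hypotheses (k_gt1 : 1 < k) (clQ : is_clique Q).

Notation H := (join_copies k G).
Notation m := #|~: Q|.

(** The position of a vertex of the join outside the copies of [Q] in the order
that cycles through the copies, so that consecutive vertices lie in different
copies as soon as [1 < k]. *)
Definition pos (x : H) : nat := x.1 + k * index x.2 (enum (~: Q)).

(** The matching pairs the vertices in positions [2 * s] and [2 * s + 1]. *)
Definition join_color (x : H) : option ('I_k * {u | u \in Q} + 'I_(k * m)./2) :=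
  if insub x.2 is Some q then Some (inl (x.1, q))
  else omap inr (insub (pos x)./2).

Lemma pos_surj s : s < k * m ->
  exists x : H, [/\ x.2 \notin Q, pos x = s & x.1 = s %% k :> nat].
Proof.
move=> s_lt; have k_gt0 : 0 < k by lia.
have q_lt : s %/ k < m by rewrite ltn_divLR // mulnC.
exists (Ordinal (ltn_pmod s k_gt0), enum_val (Ordinal q_lt)); split=> //=.
  by have := enum_valP (Ordinal q_lt); rewrite inE.
rewrite /pos /= /enum_val index_uniq ?enum_uniq -?cardE //.
by rewrite addnC mulnC -divn_eq.
Qed.

Lemma pos_inj : {in [pred x : H | x.2 \notin Q] &, injective pos}.
Proof.
move=> [i u] [j v]; rewrite !inE /= => Qu Qv; rewrite /pos /= => E.
have Rv : v \in enum (~: Q) by rewrite mem_enum inE.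
have Ru : u \in enum (~: Q) by rewrite mem_enum inE.
have eij : i = j.
  apply: val_inj; have := congr1 (modn^~ k) E.
  by rewrite !(addnC _ (k * _)) !(mulnC k) !modnMDl !modn_small.
move: E; rewrite eij => /addnI /eqP; rewrite eqn_pmul2l; last by lia.
by move=> /eqP/(index_inj u Ru Rv) ->.
Qed.

Lemma join_color_clique (i : 'I_k) (q : {u | u \in Q}) :
  join_color (i, val q) = Some (inl (i, q)).
Proof. by rewrite /join_color /= valK. Qed.

Lemma join_color_matched (x : H) (s : 'I_(k * m)./2) :
  x.2 \notin Q -> (pos x)./2 = s -> join_color x = Some (inr s).
Proof. by move=> Qx Ex; rewrite /join_color insubN // Ex valK. Qed.

(** The two vertices of a pair lie in different copies, so one of them is not
in the copy of [y]. *)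
Lemma pair_meets (y : H) (s : 'I_(k * m)./2) :
  exists2 x : H, adj x y & join_color x = Some (inr s).
Proof.
have s_lt : s < (k * m)./2 by [].
have meets t : t < k * m -> t./2 = s -> t %% k != y.1 ->
    exists2 x : H, adj x y & join_color x = Some (inr s).
  move=> /pos_surj[x [Qx Ex xt]] ts ty.
  exists x; last by apply: join_color_matched; rewrite ?Ex.
  rewrite /adj /= /join_adj ifN //; apply: contra ty => /eqP <-.
  by rewrite xt.
have [Ey|] := eqVneq (s.*2 %% k) y.1; last by apply: meets; lia.
apply: (meets s.*2.+1); [lia|lia|rewrite -Ey].
(* Otherwise [k] would divide the difference 1 of consecutive positions. *)
rewrite -{2}[s.*2]addn0 -addn1 eqn_modDl mod0n modn_small //.
Qed.

(** Unlike the vertices of a pair, two vertices in copies of [Q] may lie in the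
same copy of [G]; they are then adjacent because [Q] is a clique. *)
Lemma psi_join_del_leftover :
  k * #|Q| + (k * m)./2
    <= psi (del_vertices [set x : H | join_color x == None]).
Proof.
have -> : k * #|Q| + (k * m)./2 =
          #|{: 'I_k * {u | u \in Q} + 'I_(k * m)./2}|.
  by rewrite card_sum card_prod !card_ord card_sig.
have sur c : exists x, join_color x = Some c.
  case: c => [[i q]|s]; first by exists (i, val q); apply: join_color_clique.
  have [|x [Qx Ex _]] := @pos_surj s.*2; first by have := ltn_ord s; lia.
  by exists x; apply: join_color_matched; rewrite // Ex doubleK.
apply: psi_ge_partial => // -[[i q]|s] [[j r]|t] cd.
- exists (i, val q), (j, val r); split; rewrite ?join_color_clique //.
  rewrite /adj /= /join_adj /=; case: eqP => // eij.
  apply: (clique_adj clQ (valP q) (valP r)).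
  by apply: contra cd => /eqP/val_inj->; rewrite eij.
- have [x xy fx] := pair_meets (i, val q) t.
  by exists (i, val q), x; rewrite adj_sym join_color_clique.
- have [x xy fx] := pair_meets (j, val r) s.
  by exists x, (j, val r); rewrite join_color_clique.
- have [y fy] := sur (inr t); have [x xy fx] := pair_meets y s.
  by exists x, y.
Qed.

(** There are [k * m] positions, and only the last one is left unmatched when
their number is odd. *)
Lemma card_leftover :
  odd (k * m) -> #|[set x : H | join_color x == None]| = 1.
Proof.
move=> odd_km.
have [|x [Qx Ex _]] := @pos_surj (k * m).-1; first by lia.
have colorN y :
    (join_color y == None) = (y.2 \notin Q) && ((k * m)./2 <= (pos y)./2).
  rewrite /join_color; case: insubP => [q -> //|/[dup] Qy ->] /=.
  case: insubP => [s lt_s _|]; last by rewrite -leqNgt => ->.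
  by rewrite leqNgt lt_s.
apply/eqP/cards1P; exists x; apply/setP=> y; rewrite !inE colorN.
apply/andP/eqP => [[Qy le_y]|->]; last by rewrite Qx Ex; split=> //; lia.
apply: pos_inj; rewrite ?inE // Ex.
have : index y.2 (enum (~: Q)) < m by rewrite cardE index_mem mem_enum inE.
by move: le_y (ltn_ord y.1); rewrite /pos; nia.
Qed.

End JoinColoring.

(** * Criticality *)

Theorem theorem5p3 (G : sgraph) (k : nat) (hk : 1 < k) :
  critical (join_copies k G) <-> ~~ odd (k * (clique_number G + #|G|)).
Proof.
have [Q clQ cardQ] := max_clique G.
have card_km : k * (clique_number G + #|G|) = (k * #|Q|).*2 + k * #|~: Q|.
  by rewrite -cardQ -(cardsC Q) !mulnDr; lia.
have card_H : #|join_copies k G| = k * #|G| by rewrite card_prod card_ord.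
have ub := psi_join_bound k G.
have lb := psi_join_del_leftover hk clQ.
set X := [set x | _] in lb.
split=> [crit|even_k].
  apply/negP=> odd_k; have odd_km : odd (k * #|~: Q|).
    by move: odd_k; rewrite card_km oddD odd_double.
  have card_X : #|X| = 1 by apply: card_leftover.
  have : 0 < mpd (join_copies k G) 1.
    by apply: (crit 1); rewrite -card_X max_card.
  by have := mpd_le X; rewrite card_X; lia.
move=> j /mpd_attained[Y cardY ->].
have := psi_del_bound Y; have := clique_number_join k G; have := psi_del_le X.
by rewrite cardY card_H; move: card_km even_k; rewrite mulnDr; lia.
Qed.
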